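(* Let $a_1,a_2,a_3,a_4,p_1,p_2,p_3,p_4,x_1,x_2,x_3,x_4,q_1,q_2,q_3,q_4$ be nonzero complex numbers. Put $L:=(p_1p_2p_3p_4)^{1/2}$, $L_0:=(q_1q_2q_3q_4)^{1/2}$, $X:=a_4/a_3$, $Y:=x_4/x_3$. For an integer $k\ge -1$ define $$E_k[\bar x;\bar q]:=\big(x_1(q_1q_3)^{k/2}-x_2x_4(q_2q_4)^{k/2}/x_3\big)\big(x_1(q_1q_4)^{k/2}-x_2x_3(q_2q_3)^{k/2}/x_4\big),$$ and $E_k[\bar a;\bar p]$ by the same formula with every $x_i$ replaced by $a_i$ and every $q_i$ by $p_i$. Then for every integer $n\ge 0$ (whenever no denominator vanishes) $$\sum_{k=0}^{n-1}\frac{E_{k-1}[\bar a;\bar p]}{(p_3p_4)^{(k-1)/2}}\frac{(a_1^2/p_1;p_1)_k(a_2^2/p_2;p_2)_k}{(a_1a_2p_3X/L;L/p_3)_{k+1}(a_1a_2p_4/(LX);L/p_4)_{k+1}}\cdot\frac{(x_1^2;q_1)_k(x_2^2;q_2)_k}{(x_1x_2Y;L_0/q_3)_k(x_1x_2/Y;L_0/q_4)_k}$$ $$=1-\frac{(a_1^2/p_1;p_1)_n(a_2^2/p_2;p_2)_n(x_1^2;q_1)_n(x_2^2;q_2)_n}{(a_1a_2p_3X/L;L/p_3)_n(a_1a_2p_4/(LX);L/p_4)_n(x_1x_2Y;L_0/q_3)_n(x_1x_2/Y;L_0/q_4)_n}$$ $$-\sum_{k=0}^{n-1}\frac{E_k[\bar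 x;\bar q]}{(q_3q_4)^{k/2}}\frac{(a_1^2/p_1;p_1)_{k+1}(a_2^2/p_2;p_2)_{k+1}}{(a_1a_2p_3X/L;L/p_3)_{k+1}(a_1a_2p_4/(LX);L/p_4)_{k+1}}\cdot\frac{(x_1^2;q_1)_k(x_2^2;q_2)_k}{(x_1x_2Y;L_0/q_3)_{k+1}(x_1x_2/Y;L_0/q_4)_{k+1}}.$$
   Context: For a complex number $z$, a nonzero complex base $p$ and an integer $k\ge0$, $(z;p)_k:=\prod_{j=0}^{k-1}(1-zp^j)$ (so $(z;p)_0=1$). Square roots $p_i^{1/2},q_i^{1/2}$ are fixed once and for all, and every half-integer power of a product of the $p_i$ (resp. $q_i$) is understood as the corresponding product of powers of these fixed roots, e.g. $(q_1q_3)^{k/2}=(q_1^{1/2}q_3^{1/2})^k$ and $L=p_1^{1/2}p_2^{1/2}p_3^{1/2}p_4^{1/2}$. *)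

(* Defs.v *)
From HB Require Import structures.
From mathcomp Require Import all_boot all_order all_algebra.
From mathcomp Require Import reals.
From mathcomp Require Import complex.

Set Implicit Arguments.
Unset Strict Implicit.
Unset Printing Implicit Defensive.

Import Order.TTheory GRing.Theory Num.Theory.

Local Open Scope ring_scope.

Definition qpoch (F : fieldType) (z p : F) (k : nat) : F :=
  \prod_(j < k) (1 - z * p ^+ j).

(* E_k[x; q]. The arguments r1, ..., r4 are the chosen square roots of the
   bases q1, ..., q4, so that (q_i q_j)^(k/2) is (r_i r_j)^k. The exponent k is
   an integer because k = -1 occurs. *)
Definition Efun (F : fieldType) (k : int) (x1 x2 x3 x4 r1 r2 r3 r4 : F) : F :=
  (x1 * (r1 * r3) ^ k - x2 * x4 * (r2 * r4) ^ k / x3) *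
  (x1 * (r1 * r4) ^ k - x2 * x3 * (r2 * r3) ^ k / x4).

(* Main.v *)
(* Put U k = (a1^2/p1;p1)_k (a2^2/p2;p2)_k / (...) and let V k be the analogous
   ratio of q-Pochhammer symbols in the x_i. Up to their common factors, the
   increments U k - U (k+1) and V k - V (k+1) are E_{k-1}[a;p] and E_k[x;q], so
   the identity is summation by parts for the product U V. *)

Require Import Defs.
From HB Require Import structures.
From mathcomp Require Import all_boot all_order all_algebra.
From mathcomp Require Import reals.
From mathcomp Require Import complex.
From mathcomp Require Import ring.

Set Implicit Arguments.
Unset Strict Implicit.
Unset Printing Implicit Defensive.

Import Order.TTheory GRing.Theory Num.Theory.

Local Open Scope ring_scope.

(** Sum of u_k v_k - u_{k+1} v_{k+1} = (u_k - u_{k+1}) v_k + u_{k+1} (v_k - v_{k+1}), whose left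
    side telescopes. *)
Lemma summation_by_parts (A : comPzRingType) (u v : nat -> A) (n : nat) :
  \sum_(0 <= k < n) (u k - u k.+1) * v k =
  u 0%N * v 0%N - u n * v n - \sum_(0 <= k < n) u k.+1 * (v k - v k.+1).
Proof.
elim: n => [|n IHn]; first by rewrite !big_nil subrr subr0.
by rewrite !big_nat_recr //= IHn; ring.
Qed.

Section QPochhammer.
Variable F : fieldType.
Implicit Types z p w : F.

Lemma qpoch0 z p : qpoch z p 0 = 1.
Proof. exact: big_ord0. Qed.

Lemma qpochS z p k : qpoch z p k.+1 = qpoch z p k * (1 - z * p ^+ k).
Proof. exact: big_ord_recr. Qed.

Lemma qpoch_neq0_le z p k n :
  (k <= n)%N -> qpoch z p n != 0 -> qpoch z p k != 0.
Proof.
move=> /subnK <-; elim: (n - k)%N => // d IHd.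
by rewrite addSn qpochS mulf_eq0 negb_or => /andP[/IHd].
Qed.

(** Common shape of [U] and [V], so that one difference formula serves both. *)
Definition qratio z1 p1 z2 p2 w3 p3 w4 p4 k : F :=
  qpoch z1 p1 k * qpoch z2 p2 k / (qpoch w3 p3 k * qpoch w4 p4 k).

Lemma qratio0 z1 p1 z2 p2 w3 p3 w4 p4 :
  qratio z1 p1 z2 p2 w3 p3 w4 p4 0 = 1.
Proof. by rewrite /qratio !qpoch0 !mulr1 divr1. Qed.

(** Over the denominator at k+1, the two terms differ only in the last factors of the four
    symbols. *)
Lemma qratio_subS z1 p1 z2 p2 w3 p3 w4 p4 k :
  qpoch w3 p3 k.+1 != 0 -> qpoch w4 p4 k.+1 != 0 ->
  qratio z1 p1 z2 p2 w3 p3 w4 p4 k - qratio z1 p1 z2 p2 w3 p3 w4 p4 k.+1 =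
  ((1 - w3 * p3 ^+ k) * (1 - w4 * p4 ^+ k)
   - (1 - z1 * p1 ^+ k) * (1 - z2 * p2 ^+ k)) *
  (qpoch z1 p1 k * qpoch z2 p2 k / (qpoch w3 p3 k.+1 * qpoch w4 p4 k.+1)).
Proof.
rewrite /qratio !qpochS !mulf_eq0 !negb_or.
move=> /andP[w3k w3S] /andP[w4k w4S].
by field; rewrite w3k w3S w4k w4S.
Qed.

(** The right side is (1 - A)(1 - B) - (1 - C)(1 - D) with AB = CD = (x1 x2 (r1 r2)^k)^2, hence
    equals C + D - A - B. These are the four terms of the expanded product E_k divided by (r3
    r4)^k. *)
Lemma Efun_div (k : int) (x1 x2 x3 x4 r1 r2 r3 r4 : F) :
  x3 != 0 -> x4 != 0 -> r3 != 0 -> r4 != 0 ->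
  Efun k x1 x2 x3 x4 r1 r2 r3 r4 / (r3 * r4) ^ k =
  (1 - x1 * x2 * (x4 / x3) * (r1 * r2 * r3 * r4 / r3 ^+ 2) ^ k) *
  (1 - x1 * x2 / (x4 / x3) * (r1 * r2 * r3 * r4 / r4 ^+ 2) ^ k)
  - (1 - x1 ^+ 2 * (r1 ^+ 2) ^ k) * (1 - x2 ^+ 2 * (r2 ^+ 2) ^ k).
Proof.
move=> x3N0 x4N0 r3N0 r4N0.
have -> : r1 * r2 * r3 * r4 / r3 ^+ 2 = r1 * r2 * r4 / r3 by field.
have -> : r1 * r2 * r3 * r4 / r4 ^+ 2 = r1 * r2 * r3 / r4 by field.
(* Splits every power into the atoms r_i^k, leaving a rational identity in them. *)
rewrite /Efun !(expr2, expfzMl) -!expfV.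
have := expfz_neq0 k r3N0; have := expfz_neq0 k r4N0.
by move=> r4k r3k; field; rewrite x3N0 x4N0 r3k r4k.
Qed.

(** Source of the index k-1 in E_{k-1}[a;p]: the parameters on the a side carry a division by their
    base. The exponent becomes an integer since k = 0 gives -1. *)
Lemma mulfz_pred z p (k : nat) :
  p != 0 -> z / p * p ^+ k = z * p ^ (k%:Z - 1).
Proof. by move=> pN0; rewrite expfzDr // exprN1 mulrA mulrAC. Qed.

End QPochhammer.

Theorem theorem2p1 (R : realType)
  (a1 a2 a3 a4 p1 p2 p3 p4 x1 x2 x3 x4 q1 q2 q3 q4 : R[i])
  (ha1 : a1 != 0) (ha2 : a2 != 0) (ha3 : a3 != 0) (ha4 : a4 != 0)
  (hp1 : p1 != 0) (hp2 : p2 != 0) (hp3 : p3 != 0) (hp4 : p4 != 0)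
  (hx1 : x1 != 0) (hx2 : x2 != 0) (hx3 : x3 != 0) (hx4 : x4 != 0)
  (hq1 : q1 != 0) (hq2 : q2 != 0) (hq3 : q3 != 0) (hq4 : q4 != 0)
  (rp1 rp2 rp3 rp4 rq1 rq2 rq3 rq4 : R[i])
  (hrp1 : rp1 ^+ 2 = p1) (hrp2 : rp2 ^+ 2 = p2)
  (hrp3 : rp3 ^+ 2 = p3) (hrp4 : rp4 ^+ 2 = p4)
  (hrq1 : rq1 ^+ 2 = q1) (hrq2 : rq2 ^+ 2 = q2)
  (hrq3 : rq3 ^+ 2 = q3) (hrq4 : rq4 ^+ 2 = q4)
  (n : nat) :
  let L := rp1 * rp2 * rp3 * rp4 in
  let L0 := rq1 * rq2 * rq3 * rq4 in
  let X := a4 / a3 in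
  let Y := x4 / x3 in
  (* The n-th factors are divisible by the earlier ones, so these conditions
     cover every denominator below. *)
  qpoch (a1 * a2 * p3 * X / L) (L / p3) n != 0 ->
  qpoch (a1 * a2 * p4 / (L * X)) (L / p4) n != 0 ->
  qpoch (x1 * x2 * Y) (L0 / q3) n != 0 ->
  qpoch (x1 * x2 / Y) (L0 / q4) n != 0 ->
  \sum_(0 <= k < n)
    Efun (k%:Z - 1) a1 a2 a3 a4 rp1 rp2 rp3 rp4 / (rp3 * rp4) ^ (k%:Z - 1) *
    ((qpoch (a1 ^+ 2 / p1) p1 k * qpoch (a2 ^+ 2 / p2) p2 k) /
     (qpoch (a1 * a2 * p3 * X / L) (L / p3) k.+1 *
      qpoch (a1 * a2 * p4 / (L * X)) (L / p4) k.+1)) *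
    ((qpoch (x1 ^+ 2) q1 k * qpoch (x2 ^+ 2) q2 k) /
     (qpoch (x1 * x2 * Y) (L0 / q3) k * qpoch (x1 * x2 / Y) (L0 / q4) k))
  = 1
    - (qpoch (a1 ^+ 2 / p1) p1 n * qpoch (a2 ^+ 2 / p2) p2 n *
       qpoch (x1 ^+ 2) q1 n * qpoch (x2 ^+ 2) q2 n) /
      (qpoch (a1 * a2 * p3 * X / L) (L / p3) n *
       qpoch (a1 * a2 * p4 / (L * X)) (L / p4) n *
       qpoch (x1 * x2 * Y) (L0 / q3) n * qpoch (x1 * x2 / Y) (L0 / q4) n)
    - \sum_(0 <= k < n)
        Efun k%:Z x1 x2 x3 x4 rq1 rq2 rq3 rq4 / (rq3 * rq4) ^ k%:Z *
        ((qpoch (a1 ^+ 2 / p1) p1 k.+1 * qpoch (a2 ^+ 2 / p2) p2 k.+1) /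
         (qpoch (a1 * a2 * p3 * X / L) (L / p3) k.+1 *
          qpoch (a1 * a2 * p4 / (L * X)) (L / p4) k.+1)) *
        ((qpoch (x1 ^+ 2) q1 k * qpoch (x2 ^+ 2) q2 k) /
         (qpoch (x1 * x2 * Y) (L0 / q3) k.+1 *
          qpoch (x1 * x2 / Y) (L0 / q4) k.+1)).
Proof.
move=> L L0 X Y D3 D4 T3 T4.
have rp_neq0 r p : r ^+ 2 = p -> p != 0 -> r != 0 :> R[i].
  by move=> <-; rewrite expf_eq0.
have rp1N0 := rp_neq0 _ _ hrp1 hp1; have rp2N0 := rp_neq0 _ _ hrp2 hp2.
have rp3N0 := rp_neq0 _ _ hrp3 hp3; have rp4N0 := rp_neq0 _ _ hrp4 hp4.
have rq3N0 := rp_neq0 _ _ hrq3 hq3; have rq4N0 := rp_neq0 _ _ hrq4 hq4.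
have LN0 : L != 0 by rewrite !mulf_neq0.
have XN0 : X != 0 by rewrite mulf_neq0 ?invr_eq0.
pose U := qratio (a1 ^+ 2 / p1) p1 (a2 ^+ 2 / p2) p2
  (a1 * a2 * p3 * X / L) (L / p3) (a1 * a2 * p4 / (L * X)) (L / p4).
pose V := qratio (x1 ^+ 2) q1 (x2 ^+ 2) q2
  (x1 * x2 * Y) (L0 / q3) (x1 * x2 / Y) (L0 / q4).
have UE k : (k < n)%N -> U k - U k.+1 =
    Efun (k%:Z - 1) a1 a2 a3 a4 rp1 rp2 rp3 rp4 / (rp3 * rp4) ^ (k%:Z - 1) *
    ((qpoch (a1 ^+ 2 / p1) p1 k * qpoch (a2 ^+ 2 / p2) p2 k) /
     (qpoch (a1 * a2 * p3 * X / L) (L / p3) k.+1 *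
      qpoch (a1 * a2 * p4 / (L * X)) (L / p4) k.+1)).
  (* Here k < n unfolds to k+1 <= n, so the symbols at k+1 inherit nonvanishing from those at n. *)
  move=> kn; rewrite /U qratio_subS ?(qpoch_neq0_le kn) //; congr (_ * _).
  rewrite Efun_div // hrp1 hrp2 hrp3 hrp4 -/L -/X -!mulfz_pred ?mulf_neq0 ?invr_eq0 //.
  (* The denominator parameters, too, are an unshifted value divided by their bases [L / p3] and
     [L / p4]. *)
  have -> : a1 * a2 * p3 * X / L = a1 * a2 * X / (L / p3).
    by field; rewrite LN0 hp3.
  have -> : a1 * a2 * p4 / (L * X) = a1 * a2 / X / (L / p4).
    by field; rewrite LN0 XN0 hp4.
  by [].
have VE k : (k < n)%N -> V k - V k.+1 =
    Efun k%:Z x1 x2 x3 x4 rq1 rq2 rq3 rq4 / (rq3 * rq4) ^ k%:Z *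
    ((qpoch (x1 ^+ 2) q1 k * qpoch (x2 ^+ 2) q2 k) /
     (qpoch (x1 * x2 * Y) (L0 / q3) k.+1 *
      qpoch (x1 * x2 / Y) (L0 / q4) k.+1)).
  (* No division by the base on the x side, so the index of E stays k. *)
  move=> kn; rewrite /V qratio_subS ?(qpoch_neq0_le kn) //.
  by rewrite Efun_div // hrq1 hrq2 hrq3 hrq4.
(* [big_nat] exposes the bound k < n that [UE] requires. *)
rewrite big_nat; under eq_bigr => k /andP[_ kn] do rewrite -UE // -/(V k).
rewrite -big_nat (summation_by_parts U V); congr (_ - _ - _).
(* The boundary terms: U_0 V_0 = 1, and U_n V_n is the quotient in the statement. *)
- by rewrite /U /V !qratio0 mulr1.
- by rewrite /U /V /qratio mulf_div !mulrA.
rewrite [LHS]big_nat [RHS]big_nat; apply: eq_bigr => k /andP[_ kn].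
by rewrite VE // mulrCA mulrA.
Qed.
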